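(* Let $\mathbb{V}$ be a vector space of finite dimension $n$ over a finite field $\mathbb{F}$ with $q$ elements, and let $\Gamma(\mathbb{V})$ be its non-zero component graph with respect to a basis $\{b_1,\ldots,b_n\}$. If $q\ge 3$, then the exchange property holds for locating-dominating sets in $\Gamma(\mathbb{V})$.
   Context: Non-zero component graph: given a finite-dimensional vector space $\mathbb{V}$ over $\mathbb{F}$ with basis $\{b_1,\ldots,b_n\}$ ($n\ge 1$), $\Gamma(\mathbb{V})$ is the simple graph whose vertices are the non-zero vectors of $\mathbb{V}$; two distinct vertices are adjacent if and only if there is some $b_i$ that has non-zero coefficient in the unique linear combinations (with respect to the basis) of both. For a graph $\Gamma$ and a vertex $u$, $N(u)$ is the set of vertices adjacent to $u$. A set $L_D\subseteq V(\Gamma)$ is a locating-dominating set for $\Gamma$ if for every two distinct vertices $u,v\in V(\Gamma)\setminus L_D$ we have $\emptyset\ne N(u)\cap L_D\ne N(v)\cap L_D\ne\emptyset$ (i.e. both intersections are non-empty and they are different from each other). A locating-dominating set is minimal if it is minimal with respect to inclusion among locating-dominating sets. Exchange property: locating-dominating sets have the exchange property in $\Gamma$ if whenever $L_{D_1}$ and $L_{D_2}$ are minimal locating-dominating sets for $\Gamma$ and $u_1\in L_{D_1}$, there exists $u_2\in L_{D_2}$ such that $(L_{D_2}\setminus\{u_2\})\cup\{u_1\}$ is also a minimal locating-dominating set. *)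

(* Defs.v *)
From HB Require Import structures.
From mathcomp Require Import all_boot all_order all_algebra all_fingroup all_field.

Set Implicit Arguments.
Unset Strict Implicit.
Unset Printing Implicit Defensive.

Import GRing.Theory.
Local Open Scope ring_scope.

Section LocatingDominating.

Variables (T : finType) (adj : rel T).

Definition neighborhood (u : T) : {set T} := [set v | adj u v].

(* Domination is only required of pairs of distinct vertices outside [L]: the
   condition is vacuous when at most one vertex lies outside [L]. *)
Definition locating_dominating (L : {set T}) : bool :=
  [forall u in ~: L, forall v in ~: L, (u != v) ==>
    [&& neighborhood u :&: L != set0,
        neighborhood u :&: L != neighborhood v :&: L &
        neighborhood v :&: L != set0]].

Definition minimal_locating_dominating (L : {set T}) : bool :=
  minset locating_dominating L.

Definition exchange_property : Prop :=
  forall L1 L2 : {set T},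
    minimal_locating_dominating L1 -> minimal_locating_dominating L2 ->
  forall u1, u1 \in L1 ->
  exists2 u2, u2 \in L2 & minimal_locating_dominating ((L2 :\ u2) :|: [set u1]).

End LocatingDominating.

Section NonZeroComponentGraph.

Variables (F : finFieldType) (V : vectType F) (n : nat) (b : n.-tuple V).

(* [finvect_type V] is [V] itself, equipped with the finType structure it
   inherits from the finite field [F]. *)
Definition nonzero_vector : finType := {v : finvect_type V | v != 0}.

(* [coord b i] is the [i]-th coefficient function only when [b] is a basis. *)
Definition nonzero_component_adj : rel nonzero_vector :=
  fun u v => (u != v) &&
    [exists i : 'I_n, (coord b i (val u) != 0) && (coord b i (val v) != 0)].

Lemma nonzero_component_adj_irrefl : irreflexive nonzero_component_adj.
Proof. by move=> u; rewrite /nonzero_component_adj eqxx. Qed.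

Lemma nonzero_component_adj_sym : symmetric nonzero_component_adj.
Proof.
move=> u v; rewrite /nonzero_component_adj eq_sym; congr (_ && _).
by apply: eq_existsb => i; rewrite andbC.
Qed.

End NonZeroComponentGraph.

(* Main.v *)
(** Vectors with the same support are twins of the graph, and as [3 <= #|F|]
    every vector [u] has a twin [a *: u] other than itself.  Hence a set is
    locating-dominating iff it misses at most one vector of each support: it
    then contains a vector of support [{i}] for every [i], and these separate
    the vertices with distinct supports.  The minimal such sets miss exactly
    one vector of each support, and the missing one can be replaced by any of
    its twins. *)
Require Import Defs.
From HB Require Import structures.
From mathcomp Require Import all_boot all_order all_algebra all_fingroup all_field.

Set Implicit Arguments.
Unset Strict Implicit.
Unset Printing Implicit Defensive.

Import GRing.Theory.
Local Open Scope ring_scope.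

Section InjectiveComplement.

Variables (T : finType) (S : eqType) (f : T -> S) (P : pred {set T}).
Hypothesis P_inj : forall L : {set T}, reflect {in ~: L &, injective f} (P L).

(** The complement of a minimal set is a system of representatives for the fibres of [f]:
    injectivity allows at most one point per fibre, and a fibre lying inside [L] would let one of
    its points be removed. *)
Lemma minset_injective_complement (L : {set T}) :
  reflect ({in ~: L &, injective f} /\
           forall x, exists2 y, y \notin L & f y = f x)
          (minset P L).
Proof.
apply: (iffP minsetP) => [[/P_inj injL minL] | [injL hit]]; split=> //.
- move=> x; have [xL | xL] := boolP (x \in L); last by exists x.
  have [/exists_inP[y yL /eqP fy] | noy] :=
    boolP [exists (y | y \notin L), f y == f x]; first by exists y.
  have ne y : y \notin L -> f y = f x -> False.
    by move=> yL fy; case/exists_inP: noy; exists y => //; apply/eqP.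
  have PLx : P (L :\ x).
    apply/P_inj => y z; rewrite !inE !negb_and !negbK.
    move=> /orP[/eqP-> | yL] /orP[/eqP-> | zL] // fyz.
    + by case: (ne z zL (esym fyz)).
    + by case: (ne y yL fyz).
    + by apply: injL; rewrite ?inE.
  by move: xL; rewrite -(minL _ PLx (subsetDl _ _)) !inE eqxx.
- exact/P_inj.
(* A point [x] of [L] outside [M] would share its fibre with the representative [y] outside [L];
   both lie outside [M], so they coincide. *)
move=> M /P_inj injM sML; apply/eqP; rewrite eqEsubset sML /=.
apply/subsetP => x xL; apply: contraT => xM.
have [y yL fy] := hit x.
have yx : y = x.
  by apply: injM fy; rewrite !inE //; apply: contra yL; apply: (subsetP sML).
by rewrite yx xL in yL.
Qed.

(** In the complement, [y] replaces [x] as representative of their common fibre. *)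
Lemma minset_exchange (L : {set T}) (x y : T) :
  minset P L -> x \notin L -> y != x -> f y = f x ->
  minset P (L :\ y :|: [set x]).
Proof.
move=> /minset_injective_complement[injL hit] xL nyx fyx.
apply/minset_injective_complement; split=> [u v | z].
  have mate z : z \in ~: (L :\ y :|: [set x]) -> z = y \/ z \notin L /\ z != x.
    rewrite !inE; case: (z =P y) => [-> | _]; first by left.
    by rewrite negb_or => /andP; right.
  have ne z : z \notin L -> z != x -> f z = f y -> False.
    by move=> zL /eqP nzx fz; apply: nzx; apply: injL; rewrite ?inE // fz.
  move=> /mate[-> | [uL nux]] /mate[-> | [vL nvx]] // fuv.
  - by case: (ne v).
  - by case: (ne u).
  - by apply: injL; rewrite ?inE.
have [w wL fw] := hit z.
have [wx | nwx] := eqVneq w x.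
  by exists y; rewrite ?fyx -?wx // !inE eqxx /= wx.
by exists w; rewrite // !inE negb_or nwx negb_and wL orbT.
Qed.

End InjectiveComplement.

Section Skeleton.

Variables (F : finFieldType) (V : vectType F) (n : nat) (b : n.-tuple V).
Hypothesis hb : basis_of {:V} b.
Hypothesis hq : (3 <= #|F|)%N.

Local Notation vertex := (nonzero_vector V).
Local Notation adj := (nonzero_component_adj b).

Definition skeleton (u : vertex) : {set 'I_n} :=
  [set i | coord b i (val u) != 0].

Lemma adjE u v : adj u v = (u != v) && (skeleton u :&: skeleton v != set0).
Proof.
congr (_ && _); apply/existsP/set0Pn => -[i Hi]; exists i; move: Hi.
  by rewrite !inE.
by rewrite !inE.
Qed.

Lemma skeleton_neq0 u : skeleton u != set0.
Proof.
apply/negP => /eqP s0; have /eqP := valP u; apply.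
have -> : val u = \sum_(i < n) coord b i (val u) *: b`_i.
  by apply: coord_basis hb (memvf _).
apply: big1 => i _; have := in_set0 i; rewrite -s0 inE => /negbFE/eqP->.
by rewrite scale0r.
Qed.

Lemma exists_twin (u : vertex) : exists2 v, v != u & skeleton v = skeleton u.
Proof.
(* Scaling by [a != 0] keeps the support, and [a != 1] makes the multiple a different vector. *)
have [a /andP[a0 a1]] : exists a : F, (a != 0) && (a != 1).
  have : [set: F] != [set 0; 1].
    by apply/eqP => FE; move: hq; rewrite -cardsT FE cards2; case: (_ == _).
  rewrite eqEsubset subsetT andbT => /subsetPn[a _].
  by rewrite !inE negb_or; exists a.
have u0 : (val u : V) != 0 := valP u.
have au0 : (a *: (val u : V) : finvect_type V) != 0.
  by change (a *: (val u : V) != 0); rewrite scaler_eq0 negb_or a0.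
exists (Sub (_ : finvect_type V) au0).
  apply: contraNneq a1 => /(congr1 val); rewrite SubK => E.
  have : (a - 1) *: (val u : V) = 0.
    by rewrite scalerBl scale1r; apply/eqP; rewrite subr_eq0; apply/eqP.
  by move/eqP; rewrite scaler_eq0 (negPf u0) orbF subr_eq0.
apply/setP => i; rewrite !inE SubK.
by rewrite linearZ mulf_eq0 negb_or a0.
Qed.

Lemma exists_skeleton1 i : exists u, skeleton u = [set i].
Proof.
have fb := basis_free hb.
have bi0 : (b`_i : finvect_type V) != 0.
  apply/eqP => E; have := coord_free i i fb.
  have -> : b`_i = 0 by exact: E.
  by rewrite linear0 eqxx => /esym/eqP; rewrite oner_eq0.
exists (Sub (_ : finvect_type V) bi0); apply/setP => j; rewrite !inE SubK.
by rewrite coord_free // (eq_sym j i); case: (i == j); rewrite ?oner_eq0 ?eqxx.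
Qed.

(** By injectivity, [u] and a twin of it cannot both lie outside [L]. *)
Lemma exists_in_skeleton (L : {set vertex}) u :
  {in ~: L &, injective skeleton} ->
  exists2 v, v \in L & skeleton v = skeleton u.
Proof.
move=> injL; have [uL | uL] := boolP (u \in L); first by exists u.
have [v nvu svu] := exists_twin u; exists v => //.
apply: contraNT nvu => vL; apply/eqP.
by apply: injL; rewrite ?inE.
Qed.

Lemma locating_dominatingP (L : {set vertex}) :
  reflect {in ~: L &, injective skeleton} (locating_dominating adj L).
Proof.
apply: (iffP idP) => [/forall_inP ldL u v uL vL suv | injL].
  apply/eqP; apply: contraT => nuv.
  have /forall_inP/(_ v vL)/implyP/(_ nuv)/and3P[_ /eqP nN _] := ldL u uL.
  (* Twins have the same neighbours apart from themselves, and neither [u] nor [v] can be the vertex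
     [w] of [L]. *)
  case: nN; apply/setP => w; rewrite !inE !adjE suv.
  have [wL | wL] := boolP (w \in L); last by rewrite !andbF.
  have ne z : z \in ~: L -> z != w by rewrite inE; apply: contraNneq => ->.
  by rewrite !ne.
(* A twin of [u] inside [L] dominates [u], since supports are non-empty. *)
have dom u : u \in ~: L -> neighborhood adj u :&: L != set0.
  rewrite inE => uL; have [v vL svu] := exists_in_skeleton u injL.
  apply/set0Pn; exists v; rewrite !inE adjE vL svu setIid skeleton_neq0 !andbT.
  by apply: contraNneq uL => ->.
(* For [i] in the support of [u], a vertex of [L] with support [[set i]] is adjacent to [u], hence
   to [v], which forces [i] into the support of [v]. *)
have sub u v : u \in ~: L ->
    neighborhood adj u :&: L = neighborhood adj v :&: L ->
    skeleton u \subset skeleton v.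
  rewrite inE => uL /setP Nuv; apply/subsetP => i iu.
  have [w sw] := exists_skeleton1 i.
  have [x xL] := exists_in_skeleton w injL; rewrite {}sw => sx.
  have : x \in neighborhood adj u :&: L.
    rewrite !inE adjE sx xL andbT; apply/andP; split.
      by apply: contraNneq uL => ->.
    by apply/set0Pn; exists i; rewrite in_setI iu set11.
  rewrite Nuv in_setI in_set adjE sx => /andP[/andP[_ /set0Pn[j jvi]] _].
  by move: jvi; rewrite in_setI in_set1 => /andP[jv /eqP <-].
apply/forall_inP => u uL; apply/forall_inP => v vL; apply/implyP => nuv.
rewrite !dom // andbT /=; apply: contra nuv => /eqP Nuv; apply/eqP.
by apply: injL => //; apply/eqP; rewrite eqEsubset !sub.
Qed.

End Skeleton.

Theorem lemma2p13 (F : finFieldType) (V : vectType F) (n : nat)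
    (b : n.-tuple V) (hn : (1 <= n)%N) (hb : basis_of {:V} b)
    (hq : (3 <= #|F|)%N) :
  exchange_property (nonzero_component_adj b).
Proof.
move=> L1 L2 _ minL2 u1 _.
have [u1L2 | u1L2] := boolP (u1 \in L2).
  by exists u1; rewrite // setUC setD1K.
have [u2 nu21 su21] := exists_twin b hq u1.
have ldP := locating_dominatingP hb hq.
exists u2; last exact: (minset_exchange ldP minL2 u1L2 nu21 su21).
(* As [u1] is the one vertex of its support missing from [L2], its twin [u2] must belong to [L2]. *)
have /(minset_injective_complement ldP)[injL2 _] := minL2.
apply: contraNT nu21 => u2L2; apply/eqP.
by apply: injL2; rewrite ?inE.
Qed.
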